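(* For every knot $L$ with Jones polynomial $J_L(t)=\sum_k a_k(L)\,t^k$ and every integer $n$, the following series converges and $$a_n(L)=\sum_{i=0}^{\infty} f_{\infty,n}^{(i)}(0)\,v_i(L),\qquad\text{where } f_{\infty,n}(v)=\begin{cases}\dfrac{\sin \pi(v-n)}{\pi(v-n)} & v\ne n,\\[2mm] 1 & v=n,\end{cases}$$ and $f_{\infty,n}^{(i)}$ denotes the $i$-th derivative of $f_{\infty,n}$ with respect to $v$.
   Context: The Jones polynomial $J_L(t)$ of an oriented knot in $S^3$ is normalized by $J_{\mathrm{unknot}}=1$ and $t^{-1}J_{L_+}-tJ_{L_-}=(t^{1/2}-t^{-1/2})J_{L_0}$; for a knot it lies in $\mathbb{Z}[t,t^{-1}]$. The invariants $v_i$ are defined by the expansion $J_L(e^x)=\sum_{i=0}^\infty v_i(L)x^i$, i.e. $v_i(L)=\frac{1}{i!}\sum_{k}k^i a_k(L)$ (with $0^0=1$); $v_i$ is known to be a Vassiliev invariant of order $i$. *)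

(* Defs.v *)
From mathcomp Require Export all_boot all_order all_algebra.
From mathcomp Require Export fraction finmap.
From mathcomp Require Import ring.
From mathcomp Require Export all_classical all_reals all_analysis.

Set Implicit Arguments.
Unset Strict Implicit.
Unset Printing Implicit Defensive.

Import Order.TTheory GRing.Theory Num.Theory.
Import numFieldNormedType.Exports.

Local Open Scope classical_set_scope.
Local Open Scope ring_scope.

(* Oriented links in S^3 are represented by oriented polygonal links in
   R^3 = S^3 minus a point: a link is the finite set of its directed edges.
   Two polygonal links are isotopic iff they are related by a sequence of
   triangle moves and inverse triangle moves (Reidemeister), so that a link
   invariant is a function invariant under [triangle_move]. *)
Section PolygonalLinks.
Variable R : realType.

Definition space := 'rV[R]_3.
Definition edge := (space * space)%type.

Definition pt (x y z : R) : space := \row_(i < 3) [:: x; y; z]`_i.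

Definition hull (s : seq space) : set space :=
  [set x | exists w : 'I_(size s) -> R,
     [/\ forall i, 0 <= w i, \sum_i w i = 1 & x = \sum_i w i *: s`_i]].

Definition segment (e : edge) : set space := hull [:: e.1; e.2].

(* Every vertex is the tail of exactly one edge and the head of exactly one
   edge, and distinct edges meet at most in a common vertex, where one of them
   arrives and the other departs. *)
Definition is_link (E : {fset edge}) : Prop :=
  [/\ E <> fset0,
      forall e, e \in E -> e.1 <> e.2,
      {in E &, injective fst} /\ {in E &, injective snd},
      [fset e.1 | e in E]%fset = [fset e.2 | e in E]%fset &
      forall e f x, e \in E -> f \in E -> e <> f ->
        segment e x -> segment f x ->
        (x = e.2 /\ x = f.1) \/ (x = e.1 /\ x = f.2)].

Record link := Link { edges :> {fset edge}; linkP : is_link edges }.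

(* [next s x] is the successor of [x] in the cyclic sequence [s]. *)
Definition is_knot (L : link) : Prop :=
  exists s : seq space, uniq s /\ edges L = [fset (x, next s x) | x in s]%fset.

Definition triangle_move (L L' : link) : Prop :=
  exists p q r : space,
    [/\ (p, q) \in edges L,
        edges L' = (edges L `\ (p, q) `|` [fset (p, r); (r, q)])%fset &
        forall e x, e \in edges L -> segment e x -> hull [:: p; q; r] x ->
          segment (p, q) x].

Definition sw := pt (-1) (-1) 0.
Definition se := pt 1 (-1) 0.
Definition nw := pt (-1) 1 0.
Definition ne := pt 1 1 0.
Definition apex := pt 0 0 1.

(* The three links have the same edges E, which meet the pyramid with vertices
   sw, se, ne, nw, apex only in corners of its base.  Inside the pyramid, seen
   from z = +oo, they show a positive crossing (the strand going up to the
   right passes over), a negative crossing, and the oriented smoothing. *)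
Definition skein_triple (Lp Lm L0 : link) : Prop :=
  exists E : {fset edge},
    [/\ forall e x, e \in E -> segment e x -> hull [:: sw; se; ne; nw; apex] x ->
          x \in [:: sw; se; ne; nw],
        edges Lp = (E `|` [fset (sw, apex); (apex, ne); (se, nw)])%fset,
        edges Lm = (E `|` [fset (se, apex); (apex, nw); (sw, ne)])%fset &
        edges L0 = (E `|` [fset (sw, nw); (se, ne)])%fset].

End PolygonalLinks.

(* The Laurent polynomial \sum_k a_k z^k, for finitely supported a. *)
Definition laurent (K : unitRingType) (a : {fsfun int -> int with 0}) (z : K) : K :=
  \sum_(k <- finsupp a) (a k)%:~R * z ^ k.

(* Z[t^{1/2}, t^{-1/2}] is viewed inside Frac(Z[X]), with t^{1/2} = X. *)
Definition laurent_field := {fraction {poly int}}.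
Definition sqrt_t : laurent_field := tofrac 'X.
Definition jones_t : laurent_field := sqrt_t ^+ 2.

(* J is the Jones polynomial; these conditions determine J. *)
Record is_jones (R : realType) (J : link R -> laurent_field) : Prop := IsJones {
  jones_isotopy : forall L L', triangle_move L L' -> J L = J L';
  jones_unknot : forall (L : link R) (p q r : space R),
    edges L = [fset (p, q); (q, r); (r, p)]%fset -> J L = 1;
  jones_skein : forall Lp Lm L0, skein_triple Lp Lm L0 ->
    jones_t^-1 * J Lp - jones_t * J Lm = (sqrt_t - sqrt_t^-1) * J L0 }.

(* v_i(L) = (1 / i!) \sum_k k^i a_k(L), where a = (a_k(L))_k. *)
Definition vassiliev (R : realType) (a : {fsfun int -> int with 0}) (i : nat) : R :=
  (i`!%:R)^-1 * \sum_(k <- finsupp a) k%:~R ^+ i * (a k)%:~R.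

Lemma expR_intM (R : realType) (k : int) (x : R) :
  expR (k%:~R * x) = expR x ^ k.
Proof.
case: k => n; first by rewrite -pmulrn expRM_natl.
by rewrite NegzE mulrNz mulNr expRN -pmulrn expRM_natl -exprnN.
Qed.

(* J_L(e^x) = \sum_i v_i(L) x^i *)
Lemma vassiliev_expansion (R : realType) (a : {fsfun int -> int with 0}) (x : R) :
  series (fun i => vassiliev R a i * x ^+ i) @ \oo --> laurent a (expR x).
Proof.
have -> : series (fun i => vassiliev R a i * x ^+ i) =
  (fun N => \sum_(k <- finsupp a)
     (a k)%:~R * series (exp_coeff (k%:~R * x)) N).
  apply/funext => N; rewrite /series/=.
  under [RHS]eq_bigr do rewrite big_distrr/=.
  rewrite exchange_big/=; apply: eq_bigr => i _.
  rewrite /vassiliev big_distrr/= big_distrl/=; apply: eq_bigr => k _.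
  rewrite /exp_coeff/= exprMn.
  by ring.
apply: cvg_big => [|k _]; first exact: add_continuous.
rewrite -expR_intM; apply: cvgM; first exact: cvg_cst.
exact: is_cvg_series_exp_coeff.
Qed.

(* sin(pi (v - n)) / (pi (v - n)), extended by continuity *)
Definition f_infty (R : realType) (n : int) (v : R) : R :=
  if v == n%:~R then 1 else sin (pi * (v - n%:~R)) / (pi * (v - n%:~R)).

(* Main.v *)
(* The formula is the Taylor expansion of f_{oo,n} at 0, evaluated at the
   integers: \sum_i f_{oo,n}^(i)(0) k^i / i! = f_{oo,n}(k) = [k = n] for every
   integer k, and summing this against the finitely many coefficients a_k gives
   a_n.  The Taylor series converges everywhere because sin(pi w) / (pi w) is an
   entire function of exponential type: its coefficients are bounded by
   pi^m / m!, so its i-th derivative is O(pi^i) on bounded sets. *)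
Require Import Defs.
From mathcomp Require Import ring.
Set Implicit Arguments.
Unset Strict Implicit.

Import Order.TTheory GRing.Theory Num.Theory.
Import numFieldNormedType.Exports.
Local Open Scope classical_set_scope.
Local Open Scope ring_scope.

(** * Power series of exponential type *)

Section ExponentialType.
Variable R : realType.
Implicit Types (c : R^nat) (A C x : R).

(** Coefficient form of exponential type: it makes the power series entire and dominated by
    [A * expR (C * |x|)]. *)
Definition exp_bounded A C c := forall m, `|c m| <= A * (C ^+ m / m`!%:R).

(** The factor m + 1 produced by differentiation cancels against (m + 1)!, leaving one extra C. So
    each derivative keeps the type [C] and costs a factor [C]. *)
Lemma exp_bounded_diffs A C c :
  exp_bounded A C c -> exp_bounded (A * C) C (pseries_diffs c).
Proof.
move=> cAC m; rewrite /pseries_diffs normrM normr_nat.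
apply: (le_trans (ler_wpM2l _ (cAC m.+1))) => //.
by rewrite factS natrM invfM exprS le_eqVlt; apply/orP; left; apply/eqP; field;
  rewrite pnatr_eq0 -lt0n fact_gt0 addrC natr1 pnatr_eq0.
Qed.

Lemma exp_bounded_iter_diffs A C c i :
  exp_bounded A C c -> exp_bounded (A * C ^+ i) C (iter i (@pseries_diffs R) c).
Proof.
move=> cAC; elim: i => [|i IH]; first by rewrite mulr1.
by rewrite exprSr mulrA; exact: exp_bounded_diffs.
Qed.

Lemma exp_bounded_norm_le A C c x m : exp_bounded A C c ->
  `|c m * x ^+ m| <= A * exp_coeff (C * `|x|) m.
Proof.
move=> cAC; rewrite normrM normrX /exp_coeff/=.
apply: (le_trans (ler_wpM2r _ (cAC m))); first exact: exprn_ge0.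
by rewrite exprMn le_eqVlt; apply/orP; left; apply/eqP; ring.
Qed.

Lemma cvg_series_exp_coeffM A x :
  series (fun m => A * exp_coeff x m) @ \oo --> A * expR x.
Proof.
rewrite (_ : series _ = (fun N => A * series (exp_coeff x) N)); last first.
  by apply/funext => N; rewrite /series/= big_distrr.
by apply: cvgMl_tmp; exact: is_cvg_series_exp_coeff.
Qed.

Lemma is_cvg_exp_bounded_norm A C c x : exp_bounded A C c ->
  cvgn [normed pseries c x].
Proof.
move=> cAC; apply: (@series_le_cvg _ _ (fun m => A * exp_coeff (C * `|x|) m)).
- by move=> m; exact: normr_ge0.
- by move=> m; exact: le_trans (normr_ge0 _) (exp_bounded_norm_le x m cAC).
- by move=> m; exact: exp_bounded_norm_le.
- by apply/cvg_ex; eexists; exact: cvg_series_exp_coeffM.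
Qed.

Lemma is_cvg_exp_bounded A C c x : exp_bounded A C c -> cvgn (pseries c x).
Proof. by move=> /is_cvg_exp_bounded_norm cAC; exact: normed_cvg. Qed.

Lemma exp_bounded_lim_le A C c x : exp_bounded A C c ->
  `|limn (pseries c x)| <= A * expR (C * `|x|).
Proof.
move=> cAC; apply: (le_trans (lim_series_norm _)).
  exact: is_cvg_exp_bounded_norm cAC.
rewrite -(cvg_lim _ (@cvg_series_exp_coeffM A (C * `|x|)))//.
apply: lim_series_le.
- exact: is_cvg_exp_bounded_norm cAC.
- by apply/cvg_ex; eexists; exact: cvg_series_exp_coeffM.
- by move=> m; exact: exp_bounded_norm_le.
Qed.

Lemma is_derive_exp_bounded A C c x : exp_bounded A C c ->
  is_derive x (1 : R) (fun y => limn (pseries c y))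
    (limn (pseries (pseries_diffs c) x)).
Proof.
(* Termwise differentiation asks for convergence at some point strictly beyond |x|; as the series
   converge everywhere, |x| + 1 serves. *)
move=> cAC; apply: (@pseries_snd_diffs _ _ (`|x| + 1)).
- exact: is_cvg_exp_bounded cAC.
- exact: is_cvg_exp_bounded (exp_bounded_diffs cAC).
- exact: is_cvg_exp_bounded (exp_bounded_diffs (exp_bounded_diffs cAC)).
- by rewrite [ltRHS]ger0_norm ?addr_ge0// ltrDl.
Qed.

End ExponentialType.

(** * Taylor expansion on the unit interval *)

Section Taylor.
Variable R : realType.
Variable F : nat -> R -> R.
Hypothesis dF : forall i x, is_derive x (1 : R) (F i) (F i.+1 x).

(* The Taylor polynomial of [F 0] about t, evaluated at 1. *)
Definition taylor N (t : R) :=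
  \sum_(0 <= i < N) F i t * ((1 - t) ^+ i / i`!%:R).

(* The derivatives of consecutive terms telescope. *)
Lemma is_derive_taylor N t :
  is_derive t (1 : R) (taylor N.+1) (F N.+1 t * ((1 - t) ^+ N / N`!%:R)).
Proof.
elim: N => [|N IH].
  have -> : taylor 1 = F 0.
    by apply/funext => s; rewrite /taylor big_nat1 expr0 fact0 divr1 mulr1.
  by rewrite expr0 fact0 divr1 mulr1.
have -> : taylor N.+2 =
    taylor N.+1 + F N.+1 * (fun s => (1 - s) ^+ N.+1 * (N.+1`!%:R)^-1).
  by apply/funext => s; rewrite /taylor big_nat_recr.
have d1 : is_derive t (1 : R) (fun s : R => (1 - s) ^+ N.+1 * (N.+1`!%:R)^-1)
    (- ((1 - t) ^+ N / N`!%:R)).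
  rewrite (_ : (fun s => _) =
      N.+1`!%:R^-1 \*: ((cst 1 - id : R -> R) ^+ N.+1)); last first.
    by apply/funext => s; rewrite fctE/= /GRing.scale/= mulrC.
  apply: is_derive_eq.
  rewrite /GRing.scale/= sub0r mulrN1 factS natrM.
  by rewrite mulrN invfM mulrACA mulVf ?pnatr_eq0// mul1r mulrC.
apply: (is_derive_eq (is_deriveD IH (is_deriveM (dF _ t) d1))).
by rewrite /GRing.scale/=; ring.
Qed.

(** [taylor N.+1] moves from the partial sum at t = 0 to [F 0 1] at t = 1. The mean value theorem
    bounds the change by B C^(N+1) / N!, which tends to 0. *)
Lemma taylor_cvg (B C : R) :
  (forall i t, 0 <= t <= 1 -> `|F i t| <= B * C ^+ i) ->
  series (fun i => F i 0 / i`!%:R) @ \oo --> F 0 1.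
Proof.
move=> FBC.
have taylor0 N : taylor N 0 = series (fun i => F i 0 / i`!%:R) N.
  by apply: eq_bigr => i _; rewrite subr0 expr1n mul1r.
have taylor1 N : taylor N.+1 1 = F 0 1.
  rewrite /taylor big_nat_recl// subrr expr0 fact0 divr1 mulr1.
  by rewrite big1 ?addr0// => i _; rewrite expr0n mul0r mulr0.
(* The empty partial sum is dropped, since [taylor1] needs the term i = 0. *)
rewrite -cvg_shiftS/=.
apply/subr_cvg0; apply: norm_cvg0.
apply: (@squeeze_cvgr _ _ _ _ (fun=> 0) (fun N => B * C * exp_coeff C N)).
- apply: nearW => N; rewrite normr_ge0/=.
  rewrite -taylor0 distrC -(taylor1 N).
  have ctaylor : {within `[0, 1], continuous (taylor N.+1)}.
    apply: derivable_within_continuous => t _.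
    by have [] := is_derive_taylor N t.
  have [t] := MVT ltr01 (fun x _ => is_derive_taylor N x) ctaylor.
  rewrite in_itv/= => /andP[/ltW t0 /ltW t1] ->.
  rewrite subr0 mulr1 normrM normf_div normr_nat.
  rewrite [ `|(1 - t) ^+ N|]ger0_norm ?exprn_ge0 ?subr_ge0//.
  rewrite (_ : _ * _ * _ = B * C ^+ N.+1 * (1 / N`!%:R)); last first.
    by rewrite /exp_coeff/= exprS mul1r !mulrA.
  rewrite ler_pM ?divr_ge0 ?exprn_ge0 ?subr_ge0//.
    by apply: FBC; rewrite t0 t1.
  by rewrite ler_wpM2r ?invr_ge0// exprn_ile1 ?subr_ge0// gerBl.
- exact: cvg_cst.
- rewrite -[0 in X in _ --> X](mulr0 (B * C)).
  by apply: cvgMl_tmp; apply: cvg_series_cvg_0; exact: is_cvg_series_exp_coeff.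
Qed.

End Taylor.

(** * The cardinal sine and its derivatives *)

Section Sinc.
Variable R : realType.

(** Taylor coefficients at 0 of sin(pi w) / (pi w): those of sin(pi w) shifted by one index and
    divided by pi. *)
Definition sinc_coeff (m : nat) : R :=
  (~~ odd m)%:R * (-1) ^+ m./2 * pi ^+ m / m.+1`!%:R.

Lemma exp_bounded_sinc_coeff : exp_bounded 1 pi sinc_coeff.
Proof.
move=> m; rewrite /sinc_coeff !normrM normrX normrN1 expr1n mulr1 mul1r.
rewrite normrX normfV !normr_nat (ger0_norm (pi_ge0 R)).
apply: (@le_trans _ _ (1 * pi ^+ m / m.+1`!%:R)).
  by rewrite !ler_wpM2r ?invr_ge0 ?exprn_ge0 ?pi_ge0// lern1 leq_b1.
rewrite mul1r ler_wpM2l ?exprn_ge0 ?pi_ge0//.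
by rewrite lef_pV2 ?posrE ?ltr0n ?fact_gt0// ler_nat factS leq_pmull.
Qed.

(** Multiplication by pi w shifts the series by one index and gives the sine series, whose constant
    term is 0. The product form also covers w = 0. *)
Lemma sinc_pseriesM (w : R) :
  pi * w * limn (pseries sinc_coeff w) = sin (pi * w).
Proof.
have cS := @is_cvg_exp_bounded _ _ _ _ w exp_bounded_sinc_coeff.
rewrite -(cvg_lim _ (cvgMl_tmp (a := pi * w) cS))//; apply: cvg_lim => //.
have : series (sin_coeff (pi * w)) @ \oo --> sin (pi * w).
  by rewrite unlock; exact: is_cvg_series_sin_coeff.
rewrite -cvg_shiftS; apply: cvg_trans.
rewrite (_ : (fun n => _) = (fun n => series (sin_coeff (pi * w)) n.+1))//.
apply/funext => N /=; rewrite /pseries/series/= big_nat_recl//.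
rewrite {1}/sin_coeff/= !mul0r add0r big_distrr/=.
apply: eq_bigr => m _; rewrite /sin_coeff /sinc_coeff/= !exprS !exprMn.
by ring.
Qed.

Lemma f_infty_pseries (n : int) (v : R) :
  f_infty n v = limn (pseries sinc_coeff (v - n%:~R)).
Proof.
rewrite /f_infty; case: eqVneq => [->|vn].
  rewrite subrr; apply/esym/cvg_lim => //.
  (* At the centre every nonempty partial sum equals 1; the shift discards the empty one, which is
     0. *)
  rewrite -cvg_shiftS.
  rewrite (_ : (fun N => _) = fun=> 1); first exact: cvg_cst.
  apply/funext => N; rewrite /pseries/series/= big_nat_recl//.
  rewrite big1 ?addr0 => [|i _]; last by rewrite expr0n mulr0.
  by rewrite /sinc_coeff/= !expr0 factS fact0 divr1 !mulr1.
have pw0 : pi * (v - n%:~R) != 0.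
  by rewrite mulf_neq0 ?subr_eq0// gt_eqF ?pi_gt0.
by rewrite -sinc_pseriesM mulrC mulKf.
Qed.

Lemma derive1n_f_infty (n : int) (i : nat) (v : R) :
  derive1n i (f_infty n) v =
  limn (pseries (iter i (@pseries_diffs R) sinc_coeff) (v - n%:~R)).
Proof.
elim: i v => [|i IH] v; first exact: f_infty_pseries.
rewrite derive1nS (funext IH).
rewrite derive1E.
have dS := is_derive_exp_bounded (v - n%:~R)
  (exp_bounded_iter_diffs i exp_bounded_sinc_coeff).
have dB : is_derive v (1 : R) (fun y : R => y - n%:~R) 1.
  by apply: is_derive_eq; rewrite subr0.
by have [_] := is_derive1_comp (g := fun y => y - n%:~R) dS dB; rewrite mulr1.
Qed.

(** Restricting to the segment from 0 to x reduces the claim to [taylor_cvg]: the [F i] below is the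
    i-th derivative of t |-> f(t x), by the chain rule. *)
Lemma f_infty_taylor (n : int) (x : R) :
  series (fun i => derive1n i (f_infty n) 0 * x ^+ i / i`!%:R) @ \oo -->
    f_infty n x.
Proof.
pose S i y := limn (pseries (iter i (@pseries_diffs R) sinc_coeff) y).
pose F i t := x ^+ i * S i (t * x - n%:~R).
have dF i t : is_derive t (1 : R) (F i) (F i.+1 t).
  have dS := is_derive_exp_bounded (t * x - n%:~R)
    (exp_bounded_iter_diffs i exp_bounded_sinc_coeff).
  have dB : is_derive t (1 : R) (fun y : R => y * x - n%:~R) x.
    have -> : (fun y : R => y * x - n%:~R) = x \*: id - cst n%:~R.
      by apply/funext => y; rewrite fctE/= /GRing.scale/= mulrC.
    by apply: is_derive_eq; rewrite subr0 /GRing.scale/= mulr1.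
  apply: (is_derive_eq (is_deriveZ (x ^+ i)
    (is_derive1_comp (g := fun y => y * x - n%:~R) dS dB))).
  by rewrite /F exprSr -mulrA [x * _]mulrC.
(* On the segment |t x - n| <= |x| + |n|, which gives a constant uniform in t and i; the chain rule
   contributes |x|^i and the exponential type pi^i. *)
have FBC i t : 0 <= t <= 1 ->
    `|F i t| <= expR (pi * (`|x| + `|n%:~R|)) * (`|x| * pi) ^+ i.
  move=> /andP[t0 t1]; rewrite /F normrM normrX exprMn mulrCA.
  apply: ler_wpM2l; first exact: exprn_ge0.
  apply: (le_trans (exp_bounded_lim_le _
    (exp_bounded_iter_diffs i exp_bounded_sinc_coeff))).
  rewrite mul1r [leRHS]mulrC ler_wpM2l ?exprn_ge0 ?pi_ge0//.
  rewrite ler_expR ler_wpM2l ?pi_ge0//.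
  rewrite (le_trans (ler_normB _ _))// lerD2r normrM ger0_norm//.
  by rewrite ler_piMl.
have := taylor_cvg dF FBC.
rewrite /F expr0 !mul1r f_infty_pseries.
rewrite (_ : (fun i => _) =
  (fun i => derive1n i (f_infty n) 0 * x ^+ i / i`!%:R))//.
by apply/funext => i; rewrite mul0r derive1n_f_infty [_ * x ^+ i]mulrC.
Qed.

Lemma sin_pi_int (m : int) : sin (pi * m%:~R) = 0 :> R.
Proof.
have sin_nat (p : nat) : sin (pi * p%:R) = 0 :> R.
  by rewrite mulr_natr -[_ *+ _]add0r (alternatingn (@sinDpi R)) sin0 mulr0.
case: m => p; first exact: sin_nat.
by rewrite NegzE mulrNz mulrN sinN sin_nat oppr0.
Qed.

Lemma f_infty_int (n k : int) : f_infty n (k%:~R : R) = (k == n)%:R.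
Proof.
rewrite /f_infty eqr_int; case: eqP => // _.
by rewrite -rmorphB/= sin_pi_int mul0r.
Qed.

End Sinc.

(** * Summation against the coefficients of the Jones polynomial *)

Theorem theorem4p3 (R : realType) (J : link R -> laurent_field) (hJ : is_jones J)
    (L : link R) (hL : is_knot L)
    (a : {fsfun int -> int with 0}) (ha : J L = laurent a jones_t) (n : int) :
  series (fun i : nat => derive1n i (f_infty n) 0 * vassiliev R a i) @ \oo
    --> ((a n)%:~R : R).
Proof.
(* The support of [a] is finite, so each partial sum is a finite combination of Taylor partial sums
   at the integers k, and the limit can be taken for each k separately. *)
have -> : series (fun i => derive1n i (f_infty n) 0 * vassiliev R a i) =
  (fun N => \sum_(k <- finsupp a) (a k)%:~R *
     series (fun i => derive1n i (f_infty n) 0 * k%:~R ^+ i / i`!%:R) N).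
  apply/funext => N; rewrite /series/=.
  under [RHS]eq_bigr do rewrite big_distrr/=.
  rewrite exchange_big/=; apply: eq_bigr => i _.
  rewrite /vassiliev !big_distrr/=; apply: eq_bigr => k _.
  by ring.
have -> : (a n)%:~R = \sum_(k <- finsupp a) (a k)%:~R * f_infty n k%:~R :> R.
  under eq_bigr do rewrite f_infty_int mulr_natr mulrb.
  case: (boolP (n \in finsupp a)) => [na|na].
    rewrite (bigD1_seq n) ?fset_uniq//= eqxx big1 ?addr0// => k /negbTE kn.
    by rewrite kn.
  (* For n outside the support, [a n] is the default value 0 and no k in the sum equals n. *)
  rewrite fsfun_dflt// big1_seq// => k /andP[_ ka].
  by case: eqVneq ka na => // -> ->.
apply: cvg_big => [|k _]; first exact: add_continuous.
by apply: cvgMl_tmp; exact: f_infty_taylor.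
Qed.
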